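(* Let $I$ be a non-trivial admissible ideal in $\mathbb{N}$ and let $x=\{x_k\}_{k\in\mathbb{N}}$ be a sequence of real numbers. If $x$ has a bounded $I$-nonthin subsequence, then the set $\Gamma_x^S(I)$ is a non-empty closed subset of $\mathbb{R}$.
   Context: $\mathbb{N}$ is the set of positive integers. An ideal $I$ in $\mathbb{N}$ is a class of subsets of $\mathbb{N}$ containing $\emptyset$ and closed under finite unions and under taking subsets; it is non-trivial if $\mathbb{N}\notin I$ and admissible if $\{n\}\in I$ for every $n\in\mathbb{N}$. A real sequence $\{a_n\}$ is $I$-convergent to $a$ ($I\text{-}\lim a_n=a$) if $\{n:|a_n-a|\ge\varepsilon\}\in I$ for every $\varepsilon>0$. For $K\subset\mathbb{N}$, the $I$-asymptotic density is $d_I(K)=I\text{-}\lim_{n\to\infty}\frac{|\{j\in K:j\le n\}|}{n}$, when this $I$-limit exists. ''$K$ does not have $I$-asymptotic density zero'' means that it is not the case that $d_I(K)$ exists and equals $0$ (so either $d_I(K)$ is positive or $d_I(K)$ does not exist). For an infinite set $A=\{k_1<k_2<\cdots\}\subset\mathbb{N}$, the subsequence $\{x_{k_j}\}_{j\in\mathbb{N}}$ is called $I$-nonthin if $A$ does not have $I$-asymptotic density zero. A real number $y$ is an $I$-statistical cluster point of $x$ if for every $\varepsilon>0$ the set $\{k\in\mathbb{N}:|x_k-y|<\varepsilon\}$ does not have $I$-asymptotic density zero; $\Gamma_x^S(I)$ is the set of all $I$-statistical cluster points of $x$. *)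

(* Defs.v *)
From HB Require Import structures.
From mathcomp Require Import all_boot all_order all_algebra finmap.
From mathcomp Require Import all_classical all_reals all_analysis.
Import Order.TTheory GRing.Theory Num.Theory.
Import numFieldNormedType.Exports.
Set Implicit Arguments.
Unset Strict Implicit.
Unset Printing Implicit Defensive.
Local Open Scope classical_set_scope.
Local Open Scope ring_scope.

Definition posnat := {n : nat | (0 < n)%N}.

Definition is_ideal (I : set (set posnat)) : Prop :=
  [/\ I set0,
      forall A B, I A -> I B -> I (A `|` B)
    & forall A B, A `<=` B -> I B -> I A].

Definition nontrivial_ideal (I : set (set posnat)) : Prop := ~ I setT.

Definition admissible_ideal (I : set (set posnat)) : Prop :=
  forall n : posnat, I [set n].

Definition ideal_cvg (R : realType) (I : set (set posnat)) (a : posnat -> R)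
    (l : R) : Prop :=
  forall e : R, 0 < e -> I [set n | e <= `|a n - l|].

(* [fset_set] of an infinite set is empty by convention; the sets below are
   always finite, so this is the actual cardinality. *)
Definition counting_ratio (R : realType) (K : set posnat) (n : posnat) : R :=
  (#|` fset_set [set j : posnat | K j /\ (val j <= val n)%N] |)%:R / (val n)%:R.

(* "d_I(K) exists and equals d". *)
Definition has_ideal_density (R : realType) (I : set (set posnat))
    (K : set posnat) (d : R) : Prop :=
  ideal_cvg I (counting_ratio R K) d.

Definition ideal_density_zero (R : realType) (I : set (set posnat))
    (K : set posnat) : Prop :=
  has_ideal_density I K (0 : R).

(* The subsequence of indices k_1 < k_2 < ... enumerates the infinite set
   [range k]. *)
Definition index_sequence (k : posnat -> posnat) : Prop :=
  forall i j : posnat, (val i < val j)%N -> (val (k i) < val (k j))%N.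

Definition ideal_nonthin (R : realType) (I : set (set posnat))
    (k : posnat -> posnat) : Prop :=
  ~ ideal_density_zero R I (range k).

Definition ideal_stat_cluster (R : realType) (I : set (set posnat))
    (x : posnat -> R) : set R :=
  [set y | forall e : R, 0 < e ->
     ~ ideal_density_zero R I [set k | `|x k - y| < e]].

(* Main.v *)
(* Density-zero index sets form an ideal.  Let A be the index set of a bounded
   nonthin subsequence, and let s be the supremum of the reals t for which
   {k in A : x_k <= t} has density zero.  If some {k : |x_k - s| < e} had density
   zero, the density-zero sets would persist beyond s; so s is a cluster point. *)
Require Import Defs.
From mathcomp Require Import all_boot all_order all_algebra.
From mathcomp Require Import all_classical all_reals all_analysis.
From mathcomp Require Import finmap lra.
Import Order.TTheory GRing.Theory Num.Theory.
Import numFieldNormedType.Exports.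
Local Open Scope classical_set_scope.
Local Open Scope ring_scope.

(** Makes counting with [fset_set] legitimate: comparing cardinals under inclusion and union
    requires finite sets, since an infinite one would count as empty. *)
Lemma finite_initial_segment (K : set posnat) (n : posnat) :
  finite_set [set j : posnat | K j /\ (val j <= val n)%N].
Proof.
apply: (@sub_finite_set _ _ (val @^-1` `I_(val n).+1)).
  by move=> j [_ jn] /=; rewrite ltnS.
by apply: finite_preimage (finite_II _) => i j _ _; exact: val_inj.
Qed.

Section counting_ratio.
Variable R : realType.
Implicit Types (K L : set posnat) (n : posnat).

Lemma counting_ratio_ge0 K n : 0 <= counting_ratio R K n.
Proof. by rewrite divr_ge0 ?ler0n. Qed.

Lemma counting_ratio_set0 n : counting_ratio R set0 n = 0.
Proof.
rewrite /counting_ratio; set S := mkset _.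
have -> : S = set0 by apply/seteqP; split=> j // [].
by rewrite fset_set0 cardfs0 mul0r.
Qed.

Lemma le_counting_ratio K L n :
  K `<=` L -> counting_ratio R K n <= counting_ratio R L n.
Proof.
move=> KL; rewrite ler_wpM2r ?invr_ge0 ?ler0n// ler_nat.
apply: fsubset_leq_card; rewrite -fset_set_sub; last 2 first.
- exact: finite_initial_segment.
- exact: finite_initial_segment.
by move=> j [Kj jn]; split=> //; exact: KL.
Qed.

Lemma counting_ratioU K L n :
  counting_ratio R (K `|` L) n <= counting_ratio R K n + counting_ratio R L n.
Proof.
rewrite -mulrDl ler_wpM2r ?invr_ge0 ?ler0n// -natrD ler_nat.
set S := mkset _.
have -> : S = [set j | K j /\ (val j <= val n)%N] `|`
              [set j | L j /\ (val j <= val n)%N].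
  rewrite predeqE => j; split=> [[[Kj|Lj] jn]|[[Kj jn]|[Lj jn]]];
    by [left|right|split=> //; left|split=> //; right].
(* Inclusion-exclusion; dropping the subtracted intersection gives the bound. *)
by rewrite fset_setU ?cardfsU ?leq_subr//; exact: finite_initial_segment.
Qed.

End counting_ratio.

Section density_zero.
Variables (R : realType) (I : set (set posnat)).
Hypothesis idealI : is_ideal I.
Implicit Types K L : set posnat.

(** Ratios are nonnegative, so the absolute value disappears. What remains are superlevel sets, to
    which monotonicity and subadditivity of the ratio apply directly. *)
Lemma density_zeroP K :
  ideal_density_zero R I K <->
  forall e : R, 0 < e -> I [set n | e <= counting_ratio R K n].
Proof.
have E e : [set n | e <= `|counting_ratio R K n - 0|] =
           [set n | e <= counting_ratio R K n].
  by apply/seteqP; split=> n /=; rewrite subr0 ger0_norm// counting_ratio_ge0.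
by split=> H e /H; rewrite E.
Qed.

Lemma density_zero_set0 : ideal_density_zero R I set0.
Proof.
case: idealI => I0 _ IS; apply/density_zeroP => e e0.
by apply: IS I0 => n /=; rewrite counting_ratio_set0 leNgt e0.
Qed.

Lemma sub_density_zero K L :
  K `<=` L -> ideal_density_zero R I L -> ideal_density_zero R I K.
Proof.
case: idealI => _ _ IS KL /density_zeroP L0; apply/density_zeroP => e /L0.
by apply: IS => n /= /le_trans; apply; exact: le_counting_ratio.
Qed.

Lemma density_zeroU K L :
  ideal_density_zero R I K -> ideal_density_zero R I L ->
  ideal_density_zero R I (K `|` L).
Proof.
case: idealI => _ IU IS /density_zeroP K0 /density_zeroP L0.
apply/density_zeroP => e e0; have e20 : 0 < e / 2 by rewrite divr_gt0.
(* A sum that is at least [e] has a term that is at least [e / 2]. *)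
apply: IS (IU _ _ (K0 _ e20) (L0 _ e20)) => n /= en.
have := counting_ratioU R K L n.
case: (lerP (e / 2) (counting_ratio R K n)) => [|?] ?; first by left.
by right; lra.
Qed.

Variable x : posnat -> R.

Lemma closed_stat_cluster : closed (ideal_stat_cluster I x).
Proof.
move=> y cly e e0 y0; have e20 : 0 < e / 2 by rewrite divr_gt0.
(* The window of radius [e / 2] about a cluster point [z] this close to [y] lies inside the window
   of radius [e] about [y], so the latter cannot have density zero. *)
have [z [zc yz]] := cly _ (nbhsx_ballx y (e / 2) e20).
apply: (zc _ e20); apply: sub_density_zero y0 => k /= xz.
rewrite -(subrK z (x k)) -addrA (le_lt_trans (ler_normD _ _))//.
by move: yz; rewrite -ball_normE /= distrC; lra.
Qed.

Lemma stat_cluster_nonempty (A : set posnat) (M : R) :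
  (forall j, A j -> `|x j| <= M) -> ~ ideal_density_zero R I A ->
  ideal_stat_cluster I x !=set0.
Proof.
move=> AM nA.
pose Z := [set t | ideal_density_zero R I (A `&` [set k | x k <= t])].
(* Truncating at a level above [M] keeps all of [A]. *)
have ZM : ubound Z M.
  move=> t Zt; rewrite leNgt; apply/negP => Mt; apply: nA.
  apply: sub_density_zero Zt => j Aj; split=> //=.
  by have := AM _ Aj; rewrite ler_norml => /andP[]; lra.
have Z0 : Z !=set0.
  (* This level is below every value of [x] on [A], so the truncation is empty. *)
  exists (- M - 1); apply: sub_density_zero density_zero_set0 => j [/AM] /=.
  by rewrite ler_norml => /andP[]; lra.
have supZ : has_sup Z by split; [|exists M].
exists (sup Z) => e e0 c0; have e20 : 0 < e / 2 by rewrite divr_gt0.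
have [t Zt tsup] := sup_adherent e20 supZ.
(* As [t] exceeds [sup Z - e / 2], indices of [A] with value in []t, sup Z + e / 2]] fall in the
   window of radius [e] about [sup Z]; the others are covered by [Zt]. *)
have : Z (sup Z + e / 2).
  apply: sub_density_zero (density_zeroU _ _ Zt c0) => j [Aj] /= xj.
  case: (lerP (x j) t) => [?|tx]; first by left.
  by right; rewrite /= ltr_norml; apply/andP; split; lra.
by move/(sup_upper_bound supZ); lra.
Qed.

End density_zero.

Theorem theorem3p4 (R : realType) (I : set (set posnat)) (x : posnat -> R) :
  is_ideal I -> nontrivial_ideal I -> admissible_ideal I ->
  (exists k : posnat -> posnat,
     [/\ index_sequence k, ideal_nonthin R I k & bounded_fun (x \o k)]) ->
  ideal_stat_cluster I x !=set0 /\ closed (ideal_stat_cluster I x).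
Proof.
move=> idealI _ _ [k [_ nthin [M [_ xM]]]].
split; last exact: closed_stat_cluster.
(* [bounded_fun] guarantees the bound only for constants strictly above [M], hence [M + 1]. *)
apply: (stat_cluster_nonempty _ _ idealI x _ (M + 1) _ nthin) => _ [i _ <-].
by apply: (xM (M + 1)) => //; rewrite ltrDl.
Qed.
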